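(* $\textsc{BNSL}^{\neq 0}$ is fixed-parameter tractable when parameterized by the number of dependent vertices.
   Context: Let $V$ be a finite set and $\mathcal{F}=\{f_v:2^{V\setminus\{v\}}\to\mathbb{N}_0 : v\in V\}$. For a digraph $D=(V,A)$ let $P_D(v)=\{u:uv\in A\}$ and $\texttt{score}(D)=\sum_v f_v(P_D(v))$. BNSL: given $V$, $\mathcal{F}$ and an integer $\ell$, decide whether there is an acyclic digraph $D$ on $V$ with $\texttt{score}(D)\geq\ell$. In $\textsc{BNSL}^{\neq 0}$, $\mathcal{F}$ is given in the non-zero representation: for each $v$ the collection $\Gamma_f(v)=\{Z:f_v(Z)\neq0\}$ with its values; input size $|V|+\ell+\sum_{v,P\in\Gamma_f(v)}|P|$. A vertex $v$ is dependent if its set of candidate parents $P_\to(v)=\bigcup_{Z\in\Gamma_f(v)}Z$ is non-empty. *)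

(* Defs.v *)
From mathcomp Require Import all_boot all_order all_algebra.

Set Implicit Arguments.
Unset Strict Implicit.
Unset Printing Implicit Defensive.

(** * Random access machines

    Unit-cost RAM: registers hold natural numbers and are initially 0; the
    input is a read-only array of natural numbers with random access (cells
    outside the input read as 0).  Addition and truncated subtraction are the
    only arithmetic operations, so each step lengthens the largest number by
    at most one bit (beyond the constants of the program) and the model is
    polynomially equivalent to Turing machines. *)

Inductive instr : Type :=
| Const of nat & nat
| Add of nat & nat & nat
| Sub of nat & nat & nat
| Fetch of nat & nat
| Store of nat & nat
| Read of nat & nat
| Jump of nat
| Jzero of nat & nat.

Definition program := seq instr.

Record config := Config { pc : nat; reg : nat -> nat }.

Definition upd (m : nat -> nat) (i x : nat) : nat -> nat :=
  fun j => if j == i then x else m j.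

Definition exec (w : seq nat) (a : instr) (s : config) : config :=
  let: Config l m := s in
  match a with
  | Const i c => Config l.+1 (upd m i c)
  | Add i j k => Config l.+1 (upd m i (m j + m k))
  | Sub i j k => Config l.+1 (upd m i (m j - m k))
  | Fetch i j => Config l.+1 (upd m i (m (m j)))
  | Store i j => Config l.+1 (upd m (m i) (m j))
  | Read i j => Config l.+1 (upd m i (nth 0 w (m j)))
  | Jump l' => Config l' m
  | Jzero i l' => Config (if m i == 0 then l' else l.+1) m
  end.

(* The machine halts when the program counter leaves the program; halted
   configurations are fixed points of [step]. *)
Definition step (p : program) (w : seq nat) (s : config) : config :=
  if onth p (pc s) is Some a then exec w a s else s.

Definition run (p : program) (w : seq nat) (t : nat) : config :=
  iter t (step p w) (Config 0 (fun=> 0)).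

(* On input [w], [p] halts after at most [t] steps with [y] in register 0. *)
Definition outputs_within (p : program) (w : seq nat) (t y : nat) : Prop :=
  size p <= pc (run p w t) /\ reg (run p w t) 0 = y.

Definition computable (f : nat -> nat) : Prop :=
  exists p : program, forall k, exists t, outputs_within p [:: k] t (f k).

(** * Fixed-parameter tractability *)

(* [encodes x w] says that the array [w] is a presentation of the instance
   [x]; an instance may have several presentations, and an algorithm has to be
   correct and fast on all of them. *)
Record param_problem := ParamProblem {
  instance : Type;
  yes : instance -> Prop;
  param : instance -> nat;
  isize : instance -> nat;
  encodes : instance -> seq nat -> Prop }.

(* The successor of the size only matters for instances of size 0, on which
   the bound would otherwise vanish. *)
Definition fpt (Q : param_problem) : Prop :=
  exists (p : program) (f : nat -> nat) (c : nat),
    computable f /\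
    forall (x : instance Q) (w : seq nat), encodes x w ->
    exists2 b : bool, b <-> yes x &
      outputs_within p w (f (param x) * (isize x).+1 ^ c) b.

(** * Bayesian network structure learning *)

(* The vertex set is 'I_(nV I).  A function on the subsets of V \ {v} is
   represented by its extension by 0 to all subsets of V. *)
Record bnsl := Bnsl {
  nV : nat;
  score_fun : 'I_nV -> {set 'I_nV} -> nat;
  score_fun_self : forall v (Z : {set _}), v \in Z -> score_fun v Z = 0;
  target : int }.

Definition parents n (A : {set 'I_n * 'I_n}) (v : 'I_n) : {set 'I_n} :=
  [set u | (u, v) \in A].

(* No directed cycle; a loop is a directed cycle. *)
Definition acyclic n (A : {set 'I_n * 'I_n}) : Prop :=
  forall c : seq 'I_n, ucycle (fun u v => (u, v) \in A) c -> c = [::].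

Definition score (I : bnsl) (A : {set 'I_(nV I) * 'I_(nV I)}) : nat :=
  \sum_(v < nV I) score_fun v (parents A v).

Definition bnsl_yes (I : bnsl) : Prop :=
  exists2 A : {set 'I_(nV I) * 'I_(nV I)},
    acyclic A & (target I <= (score A)%:Z)%R.

Definition nonzero_sets (I : bnsl) (v : 'I_(nV I)) : {set {set 'I_(nV I)}} :=
  [set Z | score_fun v Z != 0].

Definition candidate_parents (I : bnsl) (v : 'I_(nV I)) : {set 'I_(nV I)} :=
  \bigcup_(Z in nonzero_sets v) Z.

Definition dependent (I : bnsl) (v : 'I_(nV I)) : bool :=
  candidate_parents v != set0.

Definition num_dependent (I : bnsl) : nat :=
  #|[set v : 'I_(nV I) | dependent v]|.

(* The score values are not counted: each of them occupies one cell. *)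
Definition nonzero_size (I : bnsl) : nat :=
  nV I + `|target I|%N + \sum_(v < nV I) \sum_(Z in nonzero_sets v) #|Z|.

(* [L] lists, without repetition and in any order, the sets of
   [nonzero_sets v] together with their scores, each set being itself listed
   without repetition and in any order. *)
Definition lists_nonzero (I : bnsl) (v : 'I_(nV I))
    (L : seq (seq 'I_(nV I) * nat)) : Prop :=
  all (fun e => uniq e.1) L /\
  perm_eq [seq ([set u in e.1], e.2) | e <- L]
          [seq (Z, score_fun v Z) | Z in nonzero_sets v].

Definition entry_word n (e : seq 'I_n * nat) : seq nat :=
  e.2 :: size e.1 :: [seq val u | u <- e.1].

Definition vertex_word n (L : seq (seq 'I_n * nat)) : seq nat :=
  size L :: flatten [seq entry_word e | e <- L].

(* The target is written as a sign cell followed by its absolute value. *)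
Definition nonzero_encodes (I : bnsl) (w : seq nat) : Prop :=
  exists2 G : 'I_(nV I) -> seq (seq 'I_(nV I) * nat),
    forall v, lists_nonzero v (G v) &
    w = [:: nV I; nat_of_bool (target I < 0)%R; `|target I|%N]
        ++ flatten [seq vertex_word (G v) | v <- enum 'I_(nV I)].

Definition bnsl_nonzero_by (k : bnsl -> nat) : param_problem :=
  ParamProblem bnsl_yes k nonzero_size nonzero_encodes.

(* Main.v *)
(* Independent vertices may be taken to be sources, so an acyclic digraph is
   described, up to its score, by a rank function R with R = 0 on independent
   vertices and R <= k on the k dependent ones: vertex v may use the listed
   parent set Z as soon as R u < R v for all u in Z.  There are (k+1)^k such
   functions, the mixed-radix expansions of the numbers below (k+1)^k; the
   machine enumerates them by counting and, for each of them, finds the best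
   parent set of every vertex in one linear scan of the input.  The number of
   dependent ancestors is a rank function realising a given acyclic digraph. *)

(* [Defs] comes last so that [Sub] is the instruction, not [eqtype.Sub]. *)
From mathcomp Require Import all_boot all_order all_algebra zify.
Require Import Defs.

Set Implicit Arguments.
Unset Strict Implicit.
Unset Printing Implicit Defensive.

(** * Factors of a sequence *)

Section OccursAt.

Variable T : Type.
Implicit Types (x : T) (i : nat) (s q : seq T) (ss : seq (seq T)).

Definition occurs_at s i q : Prop := exists rest, drop i s = q ++ rest.

Lemma occurs_at0 s : occurs_at s 0 s.
Proof. by exists [::]; rewrite drop0 cats0. Qed.

Lemma occurs_at_cat s i q1 q2 :
  occurs_at s i (q1 ++ q2) -> occurs_at s i q1 /\ occurs_at s (i + size q1) q2.
Proof.
case=> rest; rewrite -catA => def_s; split; first by exists (q2 ++ rest).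
by exists rest; rewrite addnC -drop_drop def_s drop_size_cat.
Qed.

Lemma occurs_at_cons s i x q :
  occurs_at s i (x :: q) -> onth s i = Some x /\ occurs_at s i.+1 q.
Proof.
case/(@occurs_at_cat s i [:: x]) => -[rest def_s]; rewrite addn1; split=> //.
have lt_is : i < size s by rewrite -subn_gt0 -size_drop def_s.
by move: def_s; rewrite (drop_nth x lt_is) onthE (nth_map x) // => -[->].
Qed.

Lemma occurs_at_flatten s i ss k :
  k < size ss -> occurs_at s i (flatten ss) ->
  occurs_at s (i + size (flatten (take k ss))) (nth [::] ss k).
Proof.
move=> lt_k; rewrite -{1}(cat_take_drop k ss) flatten_cat (drop_nth [::] lt_k).
by case/occurs_at_cat => _ /= /occurs_at_cat[].
Qed.

End OccursAt.

Prenex Implicits occurs_at_cat occurs_at_cons occurs_at_flatten.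

Lemma occurs_at_nth (s : seq nat) i x q :
  occurs_at s i (x :: q) -> nth 0 s i = x /\ occurs_at s i.+1 q.
Proof. by case/occurs_at_cons => at_x; rewrite -odflt_onth at_x. Qed.

Lemma size_flatten_nth T (ss : seq (seq T)) :
  size (flatten ss) = \sum_(i < size ss) size (nth [::] ss i).
Proof.
by rewrite size_flatten /shape sumnE big_map (big_nth [::]) big_mkord.
Qed.

(** * A structured language and its compiler *)

Local Notation memory := (nat -> nat) (only parsing).

Inductive cmd :=
| Block of seq instr
| Seq of cmd & cmd
| If of nat & cmd & cmd
| While of nat & cmd.

Definition For (tmp r : nat) (c : cmd) : cmd :=
  While r (Seq c (Block [:: Const tmp 1; Sub r r tmp])).

Fixpoint code_size c :=
  match c with
  | Block s => size s
  | Seq c1 c2 => code_size c1 + code_size c2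
  | If _ c1 c2 => (code_size c1 + code_size c2).+2
  | While _ c => (code_size c).+2
  end.

Fixpoint compile l c : program :=
  match c with
  | Block s => s
  | Seq c1 c2 => compile l c1 ++ compile (l + code_size c1) c2
  | If r c1 c2 =>
      Jzero r (l + code_size c1).+2 :: compile l.+1 c1
      ++ Jump (l + code_size c1 + code_size c2).+2
      :: compile (l + code_size c1).+2 c2
  | While r c =>
      Jzero r (l + code_size c).+2 :: compile l.+1 c ++ [:: Jump l]
  end.

Lemma size_compile l c : size (compile l c) = code_size c.
Proof.
elim: c l => [s|c1 IH1 c2 IH2|r c1 IH1 c2 IH2|r c IH] l //=.
- by rewrite size_cat IH1 IH2.
- by rewrite size_cat /= IH1 IH2 addnS.
- by rewrite size_cat IH addn1.
Qed.

Section Semantics.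

(* The cells below [heap] are variables; only the others are written through
   pointers. *)
Variables (heap : nat) (w : seq nat).
Implicit Types (a : instr) (c : cmd) (m : memory) (t i j l r : nat).
Implicit Types (Q : nat -> memory -> Prop).

Definition effect m a : memory := reg (exec w a (Config 0 m)).

Definition admissible m a : bool :=
  match a with
  | Jump _ | Jzero _ _ => false
  | Store i _ => heap <= m i
  | _ => true
  end.

Fixpoint all_admissible m s : bool :=
  if s is a :: s' then admissible m a && all_admissible (effect m a) s'
  else true.

Inductive eval : cmd -> memory -> nat -> memory -> Prop :=
| EvalBlock s m : all_admissible m s ->
    eval (Block s) m (size s) (foldl effect m s)
| EvalSeq c1 c2 m t1 m1 t2 m2 :
    eval c1 m t1 m1 -> eval c2 m1 t2 m2 -> eval (Seq c1 c2) m (t1 + t2) m2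
| EvalIf r c1 c2 m t m' :
    eval (if m r != 0 then c1 else c2) m t m' ->
    eval (If r c1 c2) m (t + (m r != 0).+1) m'
| EvalWhileStop r c m : m r = 0 -> eval (While r c) m 1 m
| EvalWhileLoop r c m t1 m1 t2 m2 :
    m r != 0 -> eval c m t1 m1 -> eval (While r c) m1 t2 m2 ->
    eval (While r c) m (t1.+2 + t2) m2.

Lemma exec_admissible m a l :
  admissible m a -> exec w a (Config l m) = Config l.+1 (effect m a).
Proof. by case: a. Qed.

Lemma step_onth p a l m :
  onth p l = Some a -> step p w (Config l m) = exec w a (Config l m).
Proof. by rewrite /step /= => ->. Qed.

Lemma iter_step_block p s l m : all_admissible m s -> occurs_at p l s ->
  iter (size s) (step p w) (Config l m) =
    Config (l + size s) (foldl effect m s).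
Proof.
elim: s l m => [|a s IH] l m; first by rewrite addn0.
move=> /andP[adm_a adm_s] /occurs_at_cons[at_a at_s].
by rewrite iterSr (step_onth _ at_a) exec_admissible // IH // addSnnS.
Qed.

Lemma eval_compile c m t m' : eval c m t m' ->
  forall p l, occurs_at p l (compile l c) ->
  iter t (step p w) (Config l m) = Config (l + code_size c) m'.
Proof.
elim=> {c m t m'}
  [s m adm|c1 c2 m t1 m1 t2 m2 _ IH1 _ IH2|r c1 c2 m t m' _ IH|r c m r0
  |r c m t1 m1 t2 m2 r_neq0 _ IHbody _ IHloop] p l.
- exact: iter_step_block.
- case/occurs_at_cat => at1; rewrite size_compile => at2.
  by rewrite addnC iterD IH1 // IH2 // addnA.
- move=> /= /occurs_at_cons[/step_onth at_test] /occurs_at_cat[at1].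
  case/occurs_at_cons => /step_onth at_jump; rewrite size_compile in at_jump *.
  rewrite addnS iterSr at_test /=; case: eqP IH => /= _ IH at2.
    by rewrite addSn in at2; rewrite addn0 IH // !addnS addnA.
  by rewrite addn1 iterS IH // at_jump /= !addnS addnA.
- move=> /= at_loop; have [/step_onth at_test _] := occurs_at_cons at_loop.
  by rewrite at_test /= r0 eqxx !addnS.
- move=> at_loop; have [/step_onth at_test] := occurs_at_cons at_loop.
  case/occurs_at_cat => at_body /occurs_at_cons[/step_onth at_jump _].
  rewrite size_compile in at_jump.
  rewrite addnC iterD iterS iterSr at_test /= (negPf r_neq0) IHbody //.
  by rewrite at_jump /= IHloop.
Qed.

Definition spares j a : bool :=
  match a with
  | Const i _ | Add i _ _ | Sub i _ _ | Fetch i _ | Read i _ => j != i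
  | Store _ _ => j < heap
  | Jump _ | Jzero _ _ => true
  end.

Fixpoint untouched j c : bool :=
  match c with
  | Block s => all (spares j) s
  | Seq c1 c2 | If _ c1 c2 => untouched j c1 && untouched j c2
  | While _ c => untouched j c
  end.

Definition framed c m m' : Prop := forall j, untouched j c -> m' j = m j.

Lemma framed_trans c m1 m2 m3 :
  framed c m1 m2 -> framed c m2 m3 -> framed c m1 m3.
Proof. by move=> fr12 fr23 j Uj; rewrite fr23 // fr12. Qed.

Lemma effect_spares m a j : admissible m a -> spares j a -> effect m a j = m j.
Proof.
case: a => //= [i c|i k l|i k l|i k|i k|i k]; rewrite /effect /= /upd;
  try by move=> _ /negPf->.
by move=> le_i lt_j; rewrite ltn_eqF // (leq_trans lt_j).
Qed.

Lemma eval_framed c m t m' : eval c m t m' -> framed c m m'.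
Proof.
rewrite /framed; elim=> {c m t m'} /=
  [s m adm|c1 c2 m t1 m1 t2 m2 _ IH1 _ IH2|r c1 c2 m t m' _ IH|//
  |r c m t1 m1 t2 m2 _ _ IHbody _ IHloop] j.
- elim: s m adm => //= a s IH m /andP[adm_a adm_s] /andP[sp_a sp_s].
  by rewrite IH // effect_spares.
- by case/andP=> /IH1 <- /IH2.
- by case: eqP IH => /= _ IH /andP[? ?]; apply: IH.
- by move=> Uj; rewrite IHloop // IHbody.
Qed.

(** * Total correctness with running times *)

Definition wp c Q m : Prop :=
  exists t m', eval c m t m' /\ Q t m'.

(* Framing is part of the rule of consequence, so that specifications only
   mention the cells that change. *)
Lemma wp_conseq c Q Q' m :
  wp c Q m -> (forall t m', framed c m m' -> Q t m' -> Q' t m') -> wp c Q' m.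
Proof.
case=> t [m' [ev_c Qm']] sQQ'; exists t, m'; split=> //.
exact: sQQ' (eval_framed ev_c) Qm'.
Qed.

Lemma wp_skip Q m : Q 0 m -> wp (Block [::]) Q m.
Proof. by exists 0, m; split=> //; apply: (@EvalBlock [::]). Qed.

Lemma wp_block s Q m :
  all_admissible m s -> Q (size s) (foldl effect m s) -> wp (Block s) Q m.
Proof.
by move=> adm Qm; exists (size s), (foldl effect m s); split=> //; constructor.
Qed.

Lemma wp_seq c1 c2 Q m :
  wp c1 (fun t1 => wp c2 (fun t2 => Q (t1 + t2))) m -> wp (Seq c1 c2) Q m.
Proof.
case=> t1 [m1 [ev1 [t2 [m2 [ev2 Qm2]]]]].
by exists (t1 + t2), m2; split=> //; apply: EvalSeq ev2.
Qed.

Lemma wp_if r c1 c2 Q m :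
  wp (if m r != 0 then c1 else c2) (fun t => Q (t + (m r != 0).+1)) m ->
  wp (If r c1 c2) Q m.
Proof.
case=> t [m' [ev Qm']]; exists (t + (m r != 0).+1), m'.
by split=> //; constructor.
Qed.

Lemma wp_while N (cost : nat -> nat) (Inv : nat -> memory -> Prop) r c m :
  (forall i m', i <= N -> Inv i m' -> (m' r != 0) = (i < N)) ->
  (forall i m', i < N -> framed c m m' -> Inv i m' ->
     wp c (fun t m'' => t <= cost i /\ Inv i.+1 m'') m') ->
  Inv 0 m ->
  wp (While r c) (fun t m' => t <= (\sum_(i < N) (cost i).+2).+1 /\ Inv N m') m.
Proof.
move=> guard body Inv0.
suff loop d : forall i m', N - i = d -> i <= N -> framed c m m' -> Inv i m' ->
    wp (While r c) (fun t m'' =>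
      t <= (\sum_(i <= j < N) (cost j).+2).+1 /\ Inv N m'') m'.
  by rewrite -(big_mkord xpredT (fun i => (cost i).+2)); exact: loop Inv0.
elim: d => [|d IHd] i m' Nid le_iN fr Inv_i.
  have def_i : i = N by lia.
  rewrite def_i in Inv_i *.
  exists 1, m'; split; last by rewrite big_geq.
  by apply: EvalWhileStop; apply/eqP/negbFE; rewrite (guard N) ?ltnn.
have lt_iN : i < N by lia.
have [t1 [m1 [ev1 [le_t1 Inv_m1]]]] := body i m' lt_iN fr Inv_i.
have [|//||//|t2 [m2 [ev2 [le_t2 Inv_m2]]]] := IHd i.+1 m1; first lia.
  exact: framed_trans fr (eval_framed ev1).
exists (t1.+2 + t2), m2; split.
  by apply: EvalWhileLoop ev2; rewrite // (guard i).
by split=> //; rewrite big_ltn //; lia.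
Qed.

Lemma wp_for N (cost : nat -> nat) (Inv : nat -> memory -> Prop) tmp r c m :
  (r != tmp) && untouched r c -> m r = N ->
  (forall i m' x y, Inv i m' -> Inv i (upd (upd m' tmp x) r y)) ->
  (forall i m', i < N -> framed (For tmp r c) m m' -> Inv i m' ->
     wp c (fun t m'' => t <= cost i /\ Inv i.+1 m'') m') ->
  Inv 0 m ->
  wp (For tmp r c)
    (fun t m' => t <= (\sum_(i < N) (cost i + 4)).+1 /\ Inv N m') m.
Proof.
case/andP=> r_tmp Ur r_N stable body Inv0.
pose counting i (m' : memory) := m' r = N - i /\ Inv i m'.
apply: wp_conseq (wp_while (N := N) (cost := fun i => cost i + 2)
  (Inv := counting) _ _ _) _.
- by move=> i m' _ [-> _]; rewrite subn_eq0 -ltnNge.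
- move=> i m' lt_iN fr [r_i Inv_i]; apply: wp_seq.
  apply: wp_conseq (body i m' lt_iN fr Inv_i) _ => t m1 fr1 [le_t Inv_m1].
  apply: wp_block; rewrite //= /effect /= /upd /= !eqxx (negPf r_tmp).
  split; first lia.
  split; first by rewrite eqxx fr1 // r_i subn1 subnS.
  exact: stable.
- by split; rewrite // subn0.
- move=> t m' _ [le_t [_ Inv_N]]; split=> //; move: le_t.
  by congr (_ <= _.+1); apply: eq_bigr => i _; lia.
Qed.

Lemma wp_for_words K ss (Inv : nat -> memory -> Prop) tmp r pos c m :
  [&& r != tmp, pos != tmp, pos != r & untouched r c] -> m r = size ss ->
  [::] \notin ss -> occurs_at w (m pos) (flatten ss) ->
  (forall i m' x y, Inv i m' -> Inv i (upd (upd m' tmp x) r y)) ->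
  (forall i m', i < size ss -> framed (For tmp r c) m m' ->
     occurs_at w (m' pos) (nth [::] ss i) -> Inv i m' ->
     wp c (fun t m'' => [/\ t <= K * size (nth [::] ss i),
       m'' pos = m' pos + size (nth [::] ss i) & Inv i.+1 m'']) m') ->
  Inv 0 m ->
  wp (For tmp r c) (fun t m' => [/\ t <= ((K + 4) * size (flatten ss)).+1,
    m' pos = m pos + size (flatten ss) & Inv (size ss) m']) m.
Proof.
case/and4P=> r_tmp pos_tmp pos_r Ur r_ss nil_ss at_ss stable body Inv0.
pose reading i (m' : memory) :=
  m' pos = m pos + size (flatten (take i ss)) /\ Inv i m'.
apply: wp_conseq (wp_for (N := size ss) (Inv := reading)
  (cost := fun i => K * size (nth [::] ss i)) _ r_ss _ _ _) _.
- by rewrite r_tmp.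
- move=> i m' x y [pos_i Inv_i]; split; last exact: stable.
  by rewrite /upd (negPf pos_r) (negPf pos_tmp).
- move=> i m' lt_i fr [pos_i Inv_i].
  have at_i : occurs_at w (m' pos) (nth [::] ss i).
    by rewrite pos_i; exact: occurs_at_flatten lt_i at_ss.
  apply: wp_conseq (body i m' lt_i fr at_i Inv_i) _.
  move=> t m1 _ [le_t pos_m1 Inv_m1]; split=> //; split=> //.
  by rewrite (take_nth [::] lt_i) flatten_rcons size_cat pos_m1 pos_i addnA.
- by split=> //; rewrite take0 addn0.
- move=> t m' _ [le_t [pos_N Inv_N]]; rewrite take_size in pos_N; split=> //.
  apply: leq_trans le_t _; rewrite ltnS size_flatten_nth big_distrr /=.
  apply: leq_sum => i _; rewrite mulnDl leq_add2l -[leqLHS]muln1 leq_mul2l /=.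
  by rewrite lt0n size_eq0; apply: contraNneq nil_ss => <-; exact: mem_nth.
Qed.

Lemma wp_outputs c T y :
  wp c (fun t m => t <= T /\ m 0 = y) (fun=> 0) ->
  outputs_within (compile 0 c) w T y.
Proof.
case=> t [m [/eval_compile/(_ (compile 0 c) 0 (occurs_at0 _)) run_c [le_t m0]]].
have run_T : run (compile 0 c) w T = Config (code_size c) m.
  rewrite /run -(subnK le_t) iterD run_c.
  by elim: (T - t) => //= d ->; rewrite /step /= onth_default // size_compile.
by rewrite /outputs_within run_T size_compile.
Qed.

End Semantics.

(** * Mixed-radix digits *)

Section MixedRadix.

(* Digit [u] ranges over 0 .. b u. *)
Variable b : nat -> nat.

Definition weight i : nat := \prod_(j < i) (b j).+1.

Definition digit x u : nat := x %/ weight u %% (b u).+1.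

Lemma weightS i : weight i.+1 = weight i * (b i).+1.
Proof. exact: big_ord_recr. Qed.

Lemma weight_gt0 i : 0 < weight i.
Proof. exact: prodn_gt0. Qed.

Lemma digit_le x u : digit x u <= b u.
Proof. by rewrite -ltnS ltn_mod. Qed.

Lemma digit0 u : digit 0 u = 0.
Proof. by rewrite /digit div0n mod0n. Qed.

Lemma dvdn_succ_mod d q : (d.+1 %| q.+1) = (q %% d.+1 == d).
Proof.
rewrite {1}(divn_eq q d.+1) -addnS dvdn_addr ?dvdn_mull //.
apply/idP/eqP => [/dvdn_leq le_d|-> //]; have := ltn_pmod q (ltn0Sn d).
by have := le_d isT; lia.
Qed.

Lemma dvdn_weightS x u :
  (weight u.+1 %| x.+1) = (weight u %| x.+1) && (digit x u == b u).
Proof.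
rewrite -dvdn_succ_mod weightS.
have [dvd_u|ndvd_u] := boolP (weight u %| x.+1); last first.
  by apply: contraNF ndvd_u; exact: dvdn_trans (dvdn_mulr _ _).
by rewrite mulnC -dvdn_divRL // divnS ?weight_gt0 // dvd_u.
Qed.

Lemma digitS x u : digit x.+1 u =
  if weight u %| x.+1 then if digit x u == b u then 0 else (digit x u).+1
  else digit x u.
Proof.
rewrite {1}/digit divnS ?weight_gt0 //; case: ifP => // _.
by rewrite add1n modnS dvdn_succ_mod.
Qed.

(* The digits once the carry from [x] to [x.+1] has passed the first [i]. *)
Definition partial_succ x i u : nat := digit (if u < i then x.+1 else x) u.

Lemma partial_succS x i u : partial_succ x i.+1 u =
  if (u == i) && (weight i %| x.+1)
  then if partial_succ x i i == b i then 0 else (partial_succ x i i).+1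
  else partial_succ x i u.
Proof.
rewrite /partial_succ ltnn ltnS leq_eqVlt; case: eqP => //= ->.
by rewrite digitS ltnn.
Qed.

Lemma dvdn_weight i j : i <= j -> weight i %| weight j.
Proof.
move/subnKC <-; elim: (j - i) => [|d IH]; first by rewrite addn0.
by rewrite addnS weightS dvdn_mulr.
Qed.

Lemma digits_onto R n : (forall u, u < n -> R u <= b u) ->
  exists2 x, x < weight n & forall u, u < n -> digit x u = R u.
Proof.
elim: n => [|n IHn] R_le; first by exists 0; rewrite ?weight_gt0.
have [u lt_un|x lt_x digit_x] := IHn; first by rewrite R_le // ltnW.
exists (x + R n * weight n) => [|u].
  by rewrite weightS; have := R_le n (leqnn _); nia.
rewrite ltnS leq_eqVlt => /orP[/eqP-> | lt_un].
  rewrite /digit addnC divnMDl ?weight_gt0 // divn_small // addn0.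
  by rewrite modn_small // ltnS R_le.
rewrite -(digit_x u lt_un) /digit.
have /dvdnP[q ->] := dvdn_weight lt_un.
by rewrite weightS !mulnA mulnAC addnC divnMDl ?weight_gt0 // modnMDl.
Qed.

End MixedRadix.

(** * Acyclic digraphs and rank functions *)

Section Ancestors.

Variables (n : nat) (A : {set 'I_n * 'I_n}).

Let arc : rel 'I_n := fun u v => (u, v) \in A.

Lemma ranked_acyclic (R : 'I_n -> nat) :
  (forall u v, (u, v) \in A -> R u < R v) -> acyclic A.
Proof.
move=> R_arc [//|x p] /andP[/=]; rewrite rcons_path => /andP[path_p closing] _.
suff : R x <= R (last x p) by rewrite leqNgt R_arc.
elim: p x path_p {closing} => //= y p IH x /andP[/R_arc/ltnW le_xy /IH].
exact: leq_trans.
Qed.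

Hypothesis acyclicA : acyclic A.

Lemma acyclic_connect u v : (u, v) \in A -> ~~ connect arc v u.
Proof.
move=> uvA; apply/negP => /connectP[p0 /shortenP[p path_p uniq_p _] last_p].
suff /acyclicA : ucycle arc (v :: p) by [].
by rewrite /ucycle /cycle rcons_path path_p -last_p uniq_p andbT.
Qed.

Variable D : {set 'I_n}.

Definition ancestors v : {set 'I_n} := [set u in D | connect arc u v].

Lemma proper_ancestors u v :
  (u, v) \in A -> v \in D -> ancestors u \proper ancestors v.
Proof.
move=> uvA vD; apply/properP; split.
  apply/subsetP => x; rewrite !inE => /andP[-> /= x_u].
  by apply: connect_trans x_u _; exact: connect1.
by exists v; rewrite !inE vD ?connect0 //= acyclic_connect.
Qed.

End Ancestors.

Section RankScore.

Variable I : bnsl.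
Implicit Types (R : 'I_(nV I) -> nat) (v : 'I_(nV I)) (Z : {set 'I_(nV I)}).

Definition lower R v : {set 'I_(nV I)} := [set u | R u < R v].

Definition rank_score R : nat :=
  \sum_v \max_(Z in powerset (lower R v)) score_fun v Z.

Lemma eq_rank_score R R' : R =1 R' -> rank_score R = rank_score R'.
Proof.
move=> eqR; apply: eq_bigr => v _; suff -> : lower R v = lower R' v by [].
by apply/setP => u; rewrite !inE !eqR.
Qed.

Definition rank_bound v : nat := if dependent v then num_dependent I else 0.

Lemma dependentP v :
  reflect (exists u Z, score_fun v Z != 0 /\ u \in Z) (dependent v).
Proof.
apply: (iffP (set0Pn _)) => [[u /bigcupP[Z]]|[u [Z [nzZ uZ]]]].
  by rewrite inE; exists u, Z.
by exists u; apply/bigcupP; exists Z; rewrite ?inE.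
Qed.

Lemma rank_score_attained R : exists2 A, acyclic A & @score I A = rank_score R.
Proof.
have best v : {Z | Z \in powerset (lower R v) &
    \max_(Z in powerset (lower R v)) score_fun v Z = score_fun v Z}.
  by apply/eq_bigmax_cond/card_gt0P; exists set0; rewrite inE sub0set.
pose A := [set a : 'I_(nV I) * 'I_(nV I) | a.1 \in s2val (best a.2)].
exists A.
  apply: (@ranked_acyclic _ _ R) => u v; rewrite inE => uv.
  by have := s2valP (best v); rewrite inE => /subsetP/(_ u uv); rewrite inE.
apply: eq_bigr => v _; rewrite (s2valP' (best v)); congr score_fun.
by apply/setP => u; rewrite !inE.
Qed.

(* An arc into an independent vertex need not increase the rank, but the parent
   set it belongs to scores 0. *)
Lemma acyclic_score_ranked A : acyclic A ->
  exists2 R, forall v, R v <= rank_bound v & @score I A <= rank_score R.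
Proof.
move=> acA; pose D := [set v : 'I_(nV I) | dependent v].
pose R v := if dependent v then #|ancestors A D v| else 0.
exists R => [v|].
  rewrite /R /rank_bound; case: ifP => // _.
  by apply/subset_leq_card/subsetP => u; rewrite inE => /andP[].
apply: leq_sum => v _; have [->//|nz] := eqVneq (score_fun v (parents A v)) 0.
apply: leq_bigmax_cond; rewrite inE; apply/subsetP => u; rewrite !inE => uvA.
have dep_v : dependent v.
  by apply/dependentP; exists u, (parents A v); rewrite inE.
have lt_uv : #|ancestors A D u| < #|ancestors A D v|.
  by apply/proper_card/proper_ancestors; rewrite ?inE.
by rewrite /R dep_v; case: ifP => // _; exact: leq_ltn_trans lt_uv.
Qed.

Lemma bnsl_yesP : bnsl_yes I <->
  exists2 R, forall v, R v <= rank_bound v & (target I <= (rank_score R)%:Z)%R.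
Proof.
split=> [[A /acyclic_score_ranked[R R_le le_score] le_target]|[R _ le_target]].
  by exists R => //; apply: Order.POrderTheory.le_trans le_target _.
by have [A acA score_A] := rank_score_attained R; exists A; rewrite ?score_A.
Qed.

End RankScore.

(** * Listed parent sets *)

Local Notation family := (seq (seq nat * nat)) (only parsing).

Definition entry_cells (e : seq nat * nat) : seq nat := e.2 :: size e.1 :: e.1.

Definition entries_cells (L : family) : seq nat := flatten (map entry_cells L).

Definition vertex_cells (L : family) : seq nat := size L :: entries_cells L.

Definition instance_cells (Ls : seq family) : seq nat :=
  flatten (map vertex_cells Ls).

Lemma leq_size_instance_cells Ls : size Ls <= size (instance_cells Ls).
Proof.
by rewrite /instance_cells; elim: Ls => //= L Ls IH; rewrite size_cat /=; lia.
Qed.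

Definition num_members (L : family) : nat := \sum_(e <- L) size e.1.

Definition listed_members (Ls : seq family) u : nat :=
  num_members (nth [::] Ls u).

Lemma listed_members_default Ls u : size Ls <= u -> listed_members Ls u = 0.
Proof.
by move=> le_u; rewrite /listed_members nth_default // /num_members big_nil.
Qed.

Definition num_listed_dependent (Ls : seq family) : nat :=
  \sum_(u < size Ls) (listed_members Ls u != 0).

Definition best_listed (R : nat -> nat) r (L : family) : nat :=
  \max_(e <- L | all (fun u => R u < r) e.1) e.2.

Lemma best_listed_take R r L i : i < size L ->
  let e := nth ([::], 0) L i in
  best_listed R r (take i.+1 L) =
    maxn (best_listed R r (take i L))
         (if all (fun u => R u < r) e.1 then e.2 else 0).
Proof.
by move=> lt_i; rewrite /= (take_nth ([::], 0)) // /best_listed big_rcons.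
Qed.

Definition listed_score (R : nat -> nat) (Ls : seq family) : nat :=
  \sum_(v < size Ls) best_listed R (R v) (nth [::] Ls v).

(** * Memory layout *)

(* [r_vertices], [r_entries] and [r_members] count what is left to read, and
   [r_more] is 0 once the enumeration of the rank functions has overflowed.
   Cell [rank_base + 2 * u] holds the rank of the vertex u and cell
   [dep_base + 2 * u] the total size of its listed parent sets, which is
   nonzero exactly when u is dependent. *)
Local Notation r_answer := 0 (only parsing).
Local Notation r_order := 1 (only parsing).
Local Notation r_target := 2 (only parsing).
Local Notation r_dependent := 3 (only parsing).
Local Notation r_pos := 4 (only parsing).
Local Notation r_vertex := 5 (only parsing).
Local Notation r_tmp := 6 (only parsing).
Local Notation r_vertices := 7 (only parsing).
Local Notation r_entries := 8 (only parsing).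
Local Notation r_members := 9 (only parsing).
Local Notation r_value := 10 (only parsing).
Local Notation r_bad := 11 (only parsing).
Local Notation r_best := 12 (only parsing).
Local Notation r_rank := 13 (only parsing).
Local Notation r_total := 14 (only parsing).
Local Notation r_addr := 15 (only parsing).
Local Notation r_work := 16 (only parsing).
Local Notation r_size := 17 (only parsing).
Local Notation r_more := 18 (only parsing).
Local Notation heap := 20 (only parsing).
Local Notation rank_base := 20 (only parsing).
Local Notation dep_base := 21 (only parsing).

Definition stored base (m : memory) (F : nat -> nat) : Prop :=
  forall u, m (base + u + u) = F u.

Lemma stored_framed base c m m' F :
  (forall u, untouched heap (base + u + u) c) -> framed heap c m m' ->
  stored base m F -> stored base m' F.
Proof. by move=> Uc fr Fm u; rewrite fr. Qed.

Lemma stored_upd base m F v x :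
  stored base m F -> stored base (upd m (base + v + v) x) (upd F v x).
Proof.
move=> Fm u; rewrite /upd Fm.
by have -> : (base + u + u == base + v + v) = (u == v) by lia.
Qed.

Lemma stored_upd_other base base' m F v x : odd base != odd base' ->
  stored base m F -> stored base (upd m (base' + v + v) x) F.
Proof.
move=> neq_odd Fm u; rewrite /upd Fm; case: eqP => // /(congr1 odd) /eqP.
by rewrite -!addnA !oddD !addbb !addbF (negPf neq_odd).
Qed.

Definition incr r : seq instr := [:: Const r_tmp 1; Add r r r_tmp].

Definition read r : seq instr := Read r r_pos :: incr r_pos.

Definition point_to base r : seq instr :=
  [:: Const r_addr base; Add r_addr r_addr r; Add r_addr r_addr r].

Ltac run_block := apply: wp_block; rewrite //= /effect /= /upd /=.

(** * Evaluation of a rank function *)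

Definition check_members : cmd :=
  For r_tmp r_members (Block (read r_work ++ point_to rank_base r_work ++
    [:: Fetch r_work r_addr; Const r_tmp 1; Add r_work r_work r_tmp;
        Sub r_work r_work r_rank; Add r_bad r_bad r_work])).

Section Evaluation.

Variables (w : seq nat) (R : nat -> nat).

Lemma check_members_spec us m :
  stored rank_base m R -> m r_members = size us -> occurs_at w (m r_pos) us ->
  m r_bad = 0 ->
  wp heap w check_members (fun t m' => [/\ t <= (15 * size us).+1,
    m' r_pos = m r_pos + size us &
    (m' r_bad == 0) = all (fun u => R u < m r_rank) us]) m.
Proof.
move=> Rm size_us at_us bad0; have us_words := flatten_seq1 us.
pose Inv i (m' : memory) :=
  (m' r_bad == 0) = all (fun u => R u < m r_rank) (take i us).
apply: wp_conseq (wp_for_words (pos := r_pos) (K := 11) (Inv := Inv)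
  (ss := [seq [:: u] | u <- us]) _ _ _ _ _ _ _) _ => //.
- by rewrite size_map.
- by apply/mapP => -[].
- by rewrite us_words.
- move=> i m' lt_i fr; rewrite size_map in lt_i; rewrite (nth_map 0) //.
  case/occurs_at_nth=> member_u _ bad_i; run_block; rewrite member_u.
  rewrite (stored_framed _ fr Rm) // (fr r_rank isT); split=> //.
  rewrite /Inv (take_nth 0 lt_i) all_rcons -bad_i.
  by rewrite addn_eq0 andbC subn_eq0 addn1.
- by rewrite /Inv take0 bad0.
- move=> t m' _; rewrite us_words /Inv size_map take_size => -[le_t -> ->].
  by split.
Qed.

Definition improve_best : cmd :=
  For r_tmp r_entries (Seq
    (Block (read r_value ++ read r_members ++ [:: Const r_bad 0]))
    (Seq check_members
      (If r_bad (Block [::])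
        (Block [:: Sub r_value r_value r_best; Add r_best r_best r_value])))).

Lemma improve_best_spec L m :
  stored rank_base m R -> m r_entries = size L ->
  occurs_at w (m r_pos) (entries_cells L) -> m r_best = 0 ->
  wp heap w improve_best (fun t m' =>
    [/\ t <= (19 * size (entries_cells L)).+1,
      m' r_pos = m r_pos + size (entries_cells L) &
      m' r_best = best_listed R (m r_rank) L]) m.
Proof.
move=> Rm size_L at_L best0.
pose Inv i (m' : memory) := m' r_best = best_listed R (m r_rank) (take i L).
apply: wp_conseq (wp_for_words (pos := r_pos) (K := 15) (Inv := Inv)
  (ss := map entry_cells L) _ _ _ _ _ _ _) _ => //.
- by rewrite size_map.
- by apply/mapP => -[].
- move=> i m' lt_i fr; rewrite size_map in lt_i.
  rewrite (nth_map ([::], 0)) //; set e := nth _ L i.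
  case/occurs_at_nth=> value_e /occurs_at_nth[members_e at_e] best_i.
  apply: wp_seq; run_block; rewrite !addn1 value_e members_e; apply: wp_seq.
  apply: wp_conseq (check_members_spec _ _ at_e _) _ => //=.
    by apply: stored_framed fr Rm.
  move=> t m2 fr2 [le_t pos_m2 bad_m2].
  rewrite /= (fr r_rank isT) in bad_m2; rewrite /Inv in best_i.
  apply: wp_if; rewrite bad_m2 /Inv best_listed_take //= -/e.
  case: all => /=; [run_block | apply: wp_skip]; rewrite pos_m2.
    by rewrite (fr2 r_value isT) (fr2 r_best isT) /= best_i; split; lia.
  by rewrite (fr2 r_best isT) /= best_i maxn0; split; rewrite //; lia.
- by rewrite /Inv take0 best0 /best_listed big_nil.
- by move=> t m' _; rewrite /Inv size_map take_size.
Qed.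

Definition compute_total : cmd :=
  Seq (Block [:: Const r_pos 3; Const r_vertex 0; Const r_total 0;
                 Const r_vertices 0; Add r_vertices r_vertices r_order])
    (For r_tmp r_vertices (Seq
      (Block (read r_entries ++ point_to rank_base r_vertex ++
        [:: Fetch r_rank r_addr; Const r_best 0]))
      (Seq improve_best
        (Block (Add r_total r_total r_best :: incr r_vertex))))).

Lemma compute_total_spec Ls m :
  stored rank_base m R -> m r_order = size Ls ->
  occurs_at w 3 (instance_cells Ls) ->
  wp heap w compute_total (fun t m' =>
    t <= 36 * size (instance_cells Ls) + 6 /\
    m' r_total = listed_score R Ls) m.
Proof.
move=> Rm size_Ls at_Ls; apply: wp_seq; run_block.
pose Inv i (m' : memory) :=
  m' r_vertex = i /\
  m' r_total = \sum_(v < i) best_listed R (R v) (nth [::] Ls v).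
apply: wp_conseq (wp_for_words (pos := r_pos) (K := 32) (Inv := Inv)
  (ss := map vertex_cells Ls) _ _ _ _ _ _ _) _ => //=.
- by rewrite size_map.
- by apply/mapP => -[].
- move=> i m' lt_i fr; rewrite size_map in lt_i; rewrite (nth_map [::]) //.
  set L := nth _ Ls i; case/occurs_at_nth=> size_L at_L [vertex_i total_i].
  have Rm' : stored rank_base m' R by move=> u; rewrite -Rm; exact: fr.
  apply: wp_seq; run_block; rewrite vertex_i Rm' addn1 size_L; apply: wp_seq.
  apply: wp_conseq (improve_best_spec _ _ at_L _) _ => //=.
  move=> t m2 fr2 [le_t pos_m2 best_m2]; run_block.
  rewrite (fr2 r_total isT) (fr2 r_vertex isT) pos_m2 best_m2 /=.
  rewrite vertex_i total_i.
  split; [lia | lia |].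
  by split; rewrite /= ?addn1 // big_ord_recr.
- by split; rewrite ?big_ord0.
- move=> t m' _; rewrite /Inv /instance_cells size_map => -[le_t _ [_ ->]].
  by split=> //; lia.
Qed.

End Evaluation.

(** * Enumeration of the rank functions *)

Definition load_digit : cmd :=
  Seq (Block (point_to rank_base r_vertex ++ Fetch r_value r_addr ::
              point_to dep_base r_vertex ++ [:: Fetch r_work r_addr]))
  (Seq (If r_work (Block [:: Const r_work 0; Add r_work r_work r_dependent])
                  (Block [::]))
       (Block [:: Sub r_work r_work r_value])).

Definition increment_digit : cmd :=
  Seq load_digit
  (Seq (If r_work (Block (Const r_more 1 :: incr r_value))
                  (Block [:: Const r_value 0]))
       (Block (point_to rank_base r_vertex ++ [:: Store r_addr r_value]))).

Definition increment : cmd :=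
  Seq (Block [:: Const r_more 0; Const r_vertex 0;
                 Const r_vertices 0; Add r_vertices r_vertices r_order])
    (For r_tmp r_vertices
      (Seq (If r_more (Block [::]) increment_digit) (Block (incr r_vertex)))).

Section Increment.

Variables (w : seq nat) (k : nat) (D : nat -> nat).

Definition digit_bound u : nat := if D u != 0 then k else 0.

Lemma load_digit_spec R m :
  stored rank_base m R -> stored dep_base m D -> m r_dependent = k ->
  wp heap w load_digit (fun t m' => [/\ t <= 13, m' r_value = R (m r_vertex) &
    m' r_work = digit_bound (m r_vertex) - R (m r_vertex)]) m.
Proof.
move=> Rm Dm dependent_m; apply: wp_seq; run_block; rewrite Rm Dm.
apply/wp_seq/wp_if; rewrite /= /digit_bound.
case: eqP => [->|_] /=; [apply: wp_skip | run_block]; run_block => //.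
by rewrite dependent_m.
Qed.

Lemma increment_digit_spec R v m :
  stored rank_base m R -> stored dep_base m D -> m r_dependent = k ->
  m r_vertex = v -> m r_more = 0 -> R v <= digit_bound v ->
  wp heap w increment_digit (fun t m' => [/\ t <= 23,
    stored rank_base m'
      (upd R v (if R v == digit_bound v then 0 else (R v).+1)),
    stored dep_base m' D & m' r_more = (R v != digit_bound v)]) m.
Proof.
move=> Rm Dm dependent_m vertex_m more0 R_le.
apply/wp_seq/(wp_conseq (load_digit_spec Rm Dm dependent_m)).
rewrite vertex_m => t m1 fr [le_t value_m1 work_m1].
have Rm1 : stored rank_base m1 R by apply: stored_framed fr Rm.
have Dm1 : stored dep_base m1 D by apply: stored_framed fr Dm.
apply/wp_seq/wp_if; rewrite work_m1 subn_eq0 -ltnNge ltn_neqAle R_le andbT.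
case: eqP => _ /=; run_block; run_block;
  rewrite ?value_m1 ?addn1 (fr r_vertex isT) vertex_m.
- by split; [lia | exact: stored_upd | exact: stored_upd_other | rewrite fr].
- by split; [lia | exact: stored_upd | exact: stored_upd_other |].
Qed.

Variable n : nat.
Hypothesis D_default : forall u, n <= u -> D u = 0.

Lemma increment_spec x m :
  stored rank_base m (digit digit_bound x) -> stored dep_base m D ->
  m r_order = n -> m r_dependent = k ->
  wp heap w increment (fun t m' => [/\ t <= 32 * n + 5,
    stored rank_base m' (digit digit_bound x.+1), stored dep_base m' D &
    m' r_more = ~~ (weight digit_bound n %| x.+1)]) m.
Proof.
move=> Rm Dm order_m dependent_m; apply: wp_seq; run_block.
pose Inv i (m' : memory) := [/\
  stored rank_base m' (partial_succ digit_bound x i), stored dep_base m' D,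
  m' r_vertex = i & m' r_more = ~~ (weight digit_bound i %| x.+1)].
apply: wp_conseq (wp_for (N := n) (cost := fun=> 28) (Inv := Inv)
  _ _ _ _ _) _ => //=.
- move=> i m' lt_in fr [Rm' Dm' vertex_i more_i]; apply: wp_seq; apply: wp_if.
  rewrite more_i; have [carry|no_carry] /= := boolP (weight _ i %| x.+1).
    apply: wp_conseq (increment_digit_spec Rm' Dm' _ vertex_i _ _) _.
    + by rewrite (fr r_dependent isT).
    + by rewrite more_i carry.
    + exact: digit_le.
    move=> t m1 fr1 [le_t Rm1 Dm1 more_m1].
    run_block; rewrite (fr1 r_vertex isT) vertex_i; split; first lia.
    split=> //=; rewrite ?addn1 //; last first.
      by rewrite more_m1 dvdn_weightS carry /partial_succ ltnn.
    by move=> u; rewrite [LHS]Rm1 partial_succS carry andbT.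
  apply: wp_skip; run_block; rewrite vertex_i; split=> //.
  split=> //=; rewrite ?addn1 //.
    by move=> u; rewrite [LHS]Rm' partial_succS (negPf no_carry) andbF.
  by rewrite more_i dvdn_weightS (negPf no_carry).
- by split; rewrite //= /weight big_ord0 dvd1n.
- move=> t m' _ [le_t [Rm' Dm' _ more_n]]; split=> //.
    by move: le_t; rewrite sum_nat_const card_ord; lia.
  move=> u; rewrite Rm' /partial_succ; case: ltnP => // /D_default Du.
  by rewrite /digit /digit_bound Du !modn1.
Qed.

End Increment.

(** * Reading the instance *)

Definition count_members : cmd :=
  For r_tmp r_entries (Block (incr r_pos ++ read r_members ++
    [:: Add r_size r_size r_members; Add r_pos r_pos r_members])).

Definition load_vertex : cmd :=
  Seq (Block (read r_entries ++ [:: Const r_size 0]))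
  (Seq count_members
  (Seq (If r_size (Block (incr r_dependent)) (Block [::]))
       (Block (point_to dep_base r_vertex ++
               Store r_addr r_size :: incr r_vertex)))).

Definition load_vertices : cmd := For r_tmp r_vertices load_vertex.

(* A negative target is as easy to reach as the target 0. *)
Definition setup : cmd :=
  Seq (Block (read r_order ++ read r_work ++ read r_target ++
              [:: Add r_vertices r_vertices r_order]))
  (Seq (If r_work (Block [:: Const r_target 0]) (Block [::])) load_vertices).

Section Setup.

Variable w : seq nat.

Lemma count_members_spec L m :
  m r_entries = size L -> occurs_at w (m r_pos) (entries_cells L) ->
  m r_size = 0 ->
  wp heap w count_members (fun t m' =>
    [/\ t <= (8 * size (entries_cells L)).+1,
      m' r_pos = m r_pos + size (entries_cells L) &
      m' r_size = num_members L]) m.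
Proof.
move=> size_L at_L size0.
pose Inv i (m' : memory) := m' r_size = num_members (take i L).
apply: wp_conseq (wp_for_words (pos := r_pos) (K := 4) (Inv := Inv)
  (ss := map entry_cells L) _ _ _ _ _ _ _) _ => //.
- by rewrite size_map.
- by apply/mapP => -[].
- move=> i m' lt_i fr; rewrite size_map in lt_i.
  rewrite (nth_map ([::], 0)) //; set e := nth _ L i.
  case/occurs_at_nth=> _ /occurs_at_nth[members_e _] size_i; run_block.
  rewrite !addn1 members_e; split; [lia | lia |].
  by rewrite /Inv (take_nth ([::], 0) lt_i) /num_members big_rcons /= size_i.
- by rewrite /Inv take0 /num_members big_nil.
- by move=> t m' _; rewrite /Inv size_map take_size.
Qed.

Lemma load_vertex_spec L R D v m :
  occurs_at w (m r_pos) (vertex_cells L) ->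
  stored rank_base m R -> stored dep_base m D -> m r_vertex = v ->
  wp heap w load_vertex (fun t m' =>
    [/\ t <= 16 * size (vertex_cells L),
        m' r_pos = m r_pos + size (vertex_cells L),
        stored rank_base m' R /\ stored dep_base m' (upd D v (num_members L)),
        m' r_vertex = v.+1 &
        m' r_dependent = m r_dependent + (num_members L != 0)]) m.
Proof.
case/occurs_at_nth=> size_L at_L Rm Dm vertex_m; apply: wp_seq; run_block.
rewrite addn1 size_L.
apply/wp_seq/(wp_conseq (count_members_spec _ at_L _)) => //=.
move=> t m1 fr [le_t pos_m1 size_m1].
have Rm1 : stored rank_base m1 R by move=> u; rewrite -Rm; exact: fr.
have Dm1 : stored dep_base m1 D by move=> u; rewrite -Dm; exact: fr.
apply/wp_seq/wp_if; rewrite size_m1.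
have [_|_] := eqVneq (num_members L) 0; [apply: wp_skip | run_block];
  run_block; rewrite (fr r_vertex isT) (fr r_dependent isT) pos_m1 size_m1 /=;
  rewrite vertex_m !addn1; split=> //; try lia;
  by split; [exact: stored_upd_other | exact: stored_upd].
Qed.

Variable Ls : seq family.

Lemma load_vertices_spec R m :
  occurs_at w (m r_pos) (instance_cells Ls) -> m r_vertices = size Ls ->
  m r_vertex = 0 -> m r_dependent = 0 ->
  stored rank_base m R -> stored dep_base m (fun=> 0) ->
  wp heap w load_vertices (fun t m' =>
    [/\ t <= (20 * size (instance_cells Ls)).+1,
      stored rank_base m' R, stored dep_base m' (listed_members Ls) &
      m' r_dependent = num_listed_dependent Ls]) m.
Proof.
move=> at_Ls vertices_m vertex0 dependent0 Rm Dm.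
pose Inv i (m' : memory) := [/\ stored rank_base m' R,
  stored dep_base m' (fun u => if u < i then listed_members Ls u else 0),
  m' r_vertex = i & m' r_dependent = \sum_(u < i) (listed_members Ls u != 0)].
apply: wp_conseq (wp_for_words (pos := r_pos) (K := 16) (Inv := Inv)
  (ss := map vertex_cells Ls) _ _ _ _ _ _ _) _ => //.
- by rewrite size_map.
- by apply/mapP => -[].
- move=> i m' lt_i fr at_L [Rm' Dm' vertex_i dependent_i].
  rewrite size_map in lt_i; rewrite (nth_map [::]) // in at_L *.
  apply: wp_conseq (load_vertex_spec at_L Rm' Dm' vertex_i) _.
  move=> t m1 _ [le_t pos_m1 [Rm1 Dm1] vertex_m1 dependent_m1].
  split=> //; split=> //; last by rewrite dependent_m1 dependent_i big_ord_recr.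
  move=> u; rewrite Dm1 /upd; case: eqP => [->|/eqP/negPf neq_ui].
    by rewrite ltnSn.
  by rewrite ltnS [u <= i]leq_eqVlt neq_ui.
- by split; rewrite ?big_ord0.
- move=> t m' _; rewrite /Inv size_map => -[le_t _ [Rm' Dm' _ dependent_m']].
  split=> // u; rewrite Dm'; case: ltnP => // le_u.
  by rewrite listed_members_default.
Qed.

Variables negative T : nat.
Hypothesis def_w : w = [:: size Ls, negative, T & instance_cells Ls].

Lemma setup_spec :
  wp heap w setup (fun t m =>
    [/\ t <= 20 * size w, m r_answer = 0 /\ m r_order = size Ls,
        m r_dependent = num_listed_dependent Ls,
        m r_target = (if negative != 0 then 0 else T) &
        stored rank_base m (fun=> 0) /\ stored dep_base m (listed_members Ls)])
    (fun=> 0).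
Proof.
have at_Ls : occurs_at w 3 (instance_cells Ls).
  by exists [::]; rewrite def_w /= drop0 cats0.
apply: wp_seq; run_block; apply: wp_seq.
apply: (@wp_conseq _ _ _ (fun t m => t <= 3 /\
    m r_target = if negative != 0 then 0 else T)).
  apply: wp_if; rewrite def_w /=.
  by case: negative => [|?] /=; [apply: wp_skip | run_block].
move=> t1 m1 fr1 [le_t1 target_m1].
apply: wp_conseq (@load_vertices_spec (fun=> 0) _ _ _ _ _ _ _) _.
- by rewrite (fr1 r_pos isT).
- by rewrite (fr1 r_vertices isT) /= def_w.
- by rewrite (fr1 r_vertex isT).
- by rewrite (fr1 r_dependent isT).
- by move=> u; rewrite fr1.
- by move=> u; rewrite fr1.
move=> t2 m2 fr2 [le_t2 Rm2 Dm2 dependent_m2].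
split=> //; last by rewrite (fr2 r_target isT).
  by rewrite def_w /=; lia.
rewrite (fr2 r_answer isT) (fr2 r_order isT) (fr1 r_answer isT).
by rewrite (fr1 r_order isT) /= def_w.
Qed.

End Setup.

(** * The decision procedure *)

Definition test_ranks : cmd :=
  Seq compute_total
    (Seq (Block [:: Sub r_work r_target r_total])
         (If r_work (Block [::]) (Block [:: Const r_answer 1]))).

Definition search : cmd := While r_more (Seq test_ranks increment).

Definition decide : cmd := Seq setup (Seq (Block [:: Const r_more 1]) search).

Section Decide.

Variables (w : seq nat) (Ls : seq family).

Let S := size (instance_cells Ls).

Definition radix : nat -> nat :=
  digit_bound (num_listed_dependent Ls) (listed_members Ls).

Definition num_rankings : nat := weight radix (size Ls).

Definition attains T x : bool := T <= listed_score (digit radix x) Ls.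

Hypothesis at_Ls : occurs_at w 3 (instance_cells Ls).

Lemma test_ranks_spec R m :
  stored rank_base m R -> m r_order = size Ls ->
  wp heap w test_ranks (fun t m' => t <= 36 * S + 10 /\
    m' r_answer = if m r_target <= listed_score R Ls then 1 else m r_answer) m.
Proof.
move=> Rm order_m.
apply/wp_seq/(wp_conseq (compute_total_spec Rm order_m at_Ls)).
move=> t m1 fr [le_t total_m1]; apply: wp_seq; run_block; apply: wp_if.
rewrite /= total_m1 (fr r_target isT) subn_eq0.
case: leqP => _; [run_block | apply: wp_skip]; split=> //; try lia.
by rewrite (fr r_answer isT).
Qed.

Lemma search_spec m :
  stored rank_base m (fun=> 0) -> stored dep_base m (listed_members Ls) ->
  m r_answer = 0 -> m r_order = size Ls ->
  m r_dependent = num_listed_dependent Ls -> m r_more = 1 ->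
  wp heap w search (fun t m' => t <= (68 * S + 18) * num_rankings /\
    m' r_answer = has (attains (m r_target)) (iota 0 num_rankings)) m.
Proof.
move=> R0 Dm answer_m order_m dependent_m more_m.
set N := num_rankings; have N_gt0 : 0 < N by exact: weight_gt0.
have le_S : size Ls <= S by exact: leq_size_instance_cells.
pose Inv x (m' : memory) := [/\ stored rank_base m' (digit radix x),
  stored dep_base m' (listed_members Ls), m' r_more = (x < N) &
  m' r_answer = has (attains (m r_target)) (iota 0 x)].
apply: wp_conseq (wp_while (N := N) (cost := fun=> 68 * S + 15) (Inv := Inv)
  _ _ _) _.
- by move=> x m' _ [_ _ -> _]; case: ltnP.
- move=> x m' lt_xN fr [Rm' Dm' more_x answer_x].
  apply/wp_seq/(wp_conseq (test_ranks_spec Rm' _)).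
    by rewrite (fr r_order isT).
  rewrite (fr r_target isT) => t1 m1 fr1 [le_t1 answer_m1].
  apply: wp_conseq
    (increment_spec w (@listed_members_default Ls) _ _ _ _) _.
  + by apply: stored_framed fr1 Rm'.
  + by apply: stored_framed fr1 Dm'.
  + by rewrite (fr1 r_order isT) (fr r_order isT).
  + by rewrite (fr1 r_dependent isT) (fr r_dependent isT).
  move=> t2 m2 fr2 [le_t2 Rm2 Dm2 more_m2]; split; first lia.
  split=> //.
    rewrite more_m2 -/radix -/num_rankings -/N; congr nat_of_bool.
    move: lt_xN; rewrite leq_eqVlt => /orP[/eqP->|lt_xN].
      by rewrite dvdnn ltnn.
    by rewrite lt_xN gtnNdvd.
  rewrite -[x.+1]addn1 iotaD has_cat (fr2 r_answer isT) answer_m1 /= orbF.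
  by rewrite answer_x -/(attains _ x); case: attains; rewrite ?orbT ?orbF.
- split=> //; first by move=> u; rewrite R0 digit0.
  by rewrite more_m N_gt0.
- move=> t m' _ [le_t [_ _ _ answer_N]]; split=> //.
  by move: le_t; rewrite sum_nat_const card_ord; nia.
Qed.

End Decide.

Lemma decide_spec w Ls negative T :
  w = [:: size Ls, negative, T & instance_cells Ls] ->
  wp heap w decide (fun t m => t <= 89 * size w * num_rankings Ls /\
    m r_answer = has (attains Ls (if negative != 0 then 0 else T))
                     (iota 0 (num_rankings Ls))) (fun=> 0).
Proof.
move=> def_w; apply/wp_seq/(wp_conseq (setup_spec def_w)).
move=> t1 m1 _ [le_t1 [answer_m1 order_m1] dependent_m1 target_m1 [Rm1 Dm1]].
apply: wp_seq; run_block; rewrite -target_m1.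
apply: (wp_conseq (search_spec (Ls := Ls) _ _ _ _ _ _ _)) => //.
  by exists [::]; rewrite def_w /= drop0 cats0.
move=> t2 m2 _ [le_t2 answer_m2]; split=> //.
have N_gt0 : 0 < num_rankings Ls by exact: weight_gt0.
have size_w : size w = size (instance_cells Ls) + 3 by rewrite def_w /= addn3.
by rewrite size_w in le_t1 *; nia.
Qed.

(** * Decoding presentations *)

(* At most one of the sets is empty. *)
Lemma sum_card_add2 (T : finType) (S : {set {set T}}) :
  \sum_(Z in S) #|Z|.+2 <= 2 + 3 * \sum_(Z in S) #|Z|.
Proof.
have one_empty : \sum_(Z in S) (Z == set0) <= 1.
  rewrite -big_mkcondr sum1_card -(cards1 (set0 : {set T})).
  by apply/subset_leq_card/subsetP => Z; rewrite !inE => /andP[].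
apply: (@leq_trans (\sum_(Z in S) (2 * (Z == set0) + 3 * #|Z|))).
  by apply: leq_sum => Z _; rewrite -cards_eq0; lia.
by rewrite big_split /= -!big_distrr /= leq_add2r -[leqRHS]muln1 leq_mul2l.
Qed.

Section Presentation.

Variables (I : bnsl) (G : 'I_(nV I) -> seq (seq 'I_(nV I) * nat)).

Local Notation n := (nV I).
Implicit Types (v : 'I_n) (R : nat -> nat).

Definition raw_entries v : family := [seq (map val e.1, e.2) | e <- G v].

Definition raw_instance : seq family := map raw_entries (enum 'I_n).

Lemma size_raw_instance : size raw_instance = n.
Proof. by rewrite size_map size_enum_ord. Qed.

Lemma nth_raw_instance v : nth [::] raw_instance v = raw_entries v.
Proof. by rewrite (nth_map v) ?size_enum_ord // nth_ord_enum. Qed.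

Lemma vertex_word_raw v : vertex_word (G v) = vertex_cells (raw_entries v).
Proof.
rewrite /vertex_word /vertex_cells size_map /entries_cells -map_comp.
congr (_ :: flatten _); apply: eq_map => e.
by rewrite /entry_word /entry_cells /= size_map.
Qed.

Lemma presentation_word w :
  w = [:: n; nat_of_bool (target I < 0)%R; `|target I|%N]
      ++ flatten [seq vertex_word (G v) | v <- enum 'I_n] ->
  w = [:: size raw_instance, nat_of_bool (target I < 0)%R, `|target I|%N
       & instance_cells raw_instance].
Proof.
move=> ->; rewrite size_raw_instance /instance_cells /raw_instance -map_comp.
do 3 congr (_ :: _); congr flatten; apply: eq_map => v.
by rewrite vertex_word_raw.
Qed.

Hypothesis listG : forall v, lists_nonzero v (G v).

Lemma big_entries T (idx : T) (op : Monoid.com_law idx) v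
    (F : {set 'I_n} -> nat -> T) :
  \big[op/idx]_(e <- G v) F [set u in e.1] e.2 =
  \big[op/idx]_(Z in nonzero_sets v) F Z (score_fun v Z).
Proof.
have [_ perm_G] := listG v.
have := perm_big (op := op) (x := idx) (P := xpredT)
  (F := fun Zx => F Zx.1 Zx.2) _ perm_G.
by rewrite big_map big_image.
Qed.

Lemma sum_size_entries v (f : nat -> nat) :
  \sum_(e <- G v) f (size e.1) = \sum_(Z in nonzero_sets v) f #|Z|.
Proof.
have [/allP uniq_G _] := listG v.
rewrite -(big_entries _ v (fun Z _ => f #|Z|)).
by apply: eq_big_seq => e /uniq_G; rewrite cardsE => /card_uniqP->.
Qed.

Lemma size_raw_cells :
  size (instance_cells raw_instance) <= 3 * nonzero_size I.
Proof.
rewrite /instance_cells /raw_instance -map_comp size_flatten /shape -map_comp.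
rewrite sumnE big_map big_enum /=.
apply: (@leq_trans (\sum_(v < n) (3 + 3 * \sum_(Z in nonzero_sets v) #|Z|))).
  apply: leq_sum => v _; rewrite ltnS size_flatten /shape -!map_comp sumnE.
  rewrite big_map; apply: leq_trans (sum_card_add2 _).
  rewrite -(sum_size_entries v (fun x => x.+2)).
  by apply: leq_sum => e _; rewrite /= size_map.
rewrite big_split /= sum_nat_const card_ord -big_distrr mulnC -mulnDr.
by rewrite leq_mul2l leq_add2r leq_addr.
Qed.

Lemma listed_members_raw v :
  listed_members raw_instance v = \sum_(Z in nonzero_sets v) #|Z|.
Proof.
rewrite /listed_members nth_raw_instance /num_members big_map.
rewrite -(sum_size_entries v id).
by apply: eq_bigr => e _; rewrite size_map.
Qed.

Lemma listed_members_neq0 v :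
  (listed_members raw_instance v != 0) = dependent v.
Proof.
rewrite listed_members_raw sum_nat_eq0.
apply/forall_inPn/dependentP => [[Z]|[u [Z [nzZ uZ]]]].
  by rewrite inE cards_eq0 => nzZ /set0Pn[u uZ]; exists u, Z.
by exists Z; rewrite ?inE // cards_eq0; apply/set0Pn; exists u.
Qed.

Lemma num_listed_dependent_raw :
  num_listed_dependent raw_instance = num_dependent I.
Proof.
rewrite /num_listed_dependent size_raw_instance /num_dependent -sum1_card.
rewrite [RHS]big_mkcond; apply: eq_bigr => v _.
by rewrite inE listed_members_neq0; case: dependent.
Qed.

Lemma radix_raw v : radix raw_instance v = rank_bound v.
Proof.
by rewrite /radix /digit_bound listed_members_neq0 num_listed_dependent_raw.
Qed.

Lemma num_rankings_raw :
  num_rankings raw_instance = (num_dependent I).+1 ^ num_dependent I.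
Proof.
rewrite /num_rankings size_raw_instance {2}/num_dependent -prod_nat_const.
rewrite [RHS]big_mkcond; apply: eq_bigr => v _.
by rewrite inE radix_raw /rank_bound; case: dependent.
Qed.

Lemma best_listed_raw R v : best_listed R (R v) (raw_entries v) =
  \max_(Z in powerset (lower (fun u : 'I_n => R u) v)) score_fun v Z.
Proof.
set lower_v := lower _ v.
pose F (Z : {set 'I_n}) x := if Z \subset lower_v then x else 0.
transitivity (\max_(e <- G v) F [set u in e.1] e.2).
  rewrite /best_listed big_map big_mkcond; apply: eq_bigr => e _.
  congr (if _ then _ else _); rewrite all_map.
  apply/allP/subsetP => lower_e u; first by rewrite !inE; exact: lower_e.
  by move=> ue; have := lower_e u; rewrite !inE; exact.
rewrite big_entries big_mkcond [RHS]big_mkcond; apply: eq_bigr => Z _.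
by rewrite !inE /F; case: eqVneq => [->|] //=; case: ifP.
Qed.

Lemma listed_score_raw R :
  listed_score R raw_instance = rank_score (fun u : 'I_n => R u).
Proof.
rewrite /listed_score size_raw_instance; apply: eq_bigr => v _.
by rewrite nth_raw_instance best_listed_raw.
Qed.

Lemma attainsP T :
  has (attains raw_instance T) (iota 0 (num_rankings raw_instance)) <->
  exists2 R : 'I_n -> nat, forall v, R v <= rank_bound v & T <= rank_score R.
Proof.
split=> [/hasP[x _]|[R R_le le_T]].
  rewrite /attains listed_score_raw => le_T.
  exists (fun v => digit (radix raw_instance) x v) => // v.
  by rewrite -radix_raw digit_le.
pose R' u := if insub u is Some v then R v else 0.
have R'E v : R' v = R v by rewrite /R' valK.
have [u lt_un|x lt_x digit_x] := @digits_onto (radix raw_instance) R' n.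
  by rewrite -[u]/(val (Ordinal lt_un)) R'E radix_raw.
apply/hasP; exists x; first by rewrite mem_iota /num_rankings size_raw_instance.
rewrite /attains listed_score_raw.
by rewrite (@eq_rank_score _ _ R) // => v; rewrite digit_x // R'E.
Qed.

Definition truncated_target : nat :=
  if (target I < 0)%R then 0 else `|target I|%N.

Lemma leq_truncated_target s : (truncated_target <= s) = (target I <= s%:Z)%R.
Proof. by rewrite /truncated_target; case: target. Qed.

Lemma attains_yes :
  has (attains raw_instance truncated_target)
      (iota 0 (num_rankings raw_instance)) <-> bnsl_yes I.
Proof.
rewrite attainsP bnsl_yesP; split=> -[R R_le le_T]; exists R => //.
  by rewrite -leq_truncated_target.
by rewrite leq_truncated_target.
Qed.

End Presentation.

(** * Fixed-parameter tractability *)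

Lemma computable_exp2_sqr C : computable (fun k => C * 2 ^ (k * k)).
Proof.
pose square := For r_tmp r_entries (Block [:: Add r_work r_work r_dependent]).
pose double := For r_tmp r_work (Block [:: Add r_answer r_answer r_answer]).
exists (compile 0 (Seq
  (Block [:: Read r_dependent r_work; Add r_entries r_entries r_dependent])
  (Seq square (Seq (Block [:: Const r_answer C]) double)))) => k.
exists (5 * k + 5 * (k * k) + 5); apply: (@wp_outputs heap).
apply: wp_seq; run_block; apply: wp_seq.
apply: wp_conseq (wp_for (N := k) (cost := fun=> 1)
  (Inv := fun i m => m r_work = i * k) _ _ _ _ _) _ => //=.
  move=> i m _ fr work_m; run_block.
  by rewrite (fr r_dependent isT) work_m mulSn addnC.
move=> t1 m1 _ [le_t1 work_m1]; apply: wp_seq; run_block.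
apply: wp_conseq (wp_for (N := k * k) (cost := fun=> 1)
  (Inv := fun i m => m r_answer = C * 2 ^ i) _ _ _ _ _) _ => //=.
- move=> i m _ _ answer_m; run_block; rewrite answer_m expnS.
  by split=> //; lia.
- by rewrite muln1.
move=> t2 m2 _ [le_t2 answer_m2]; split=> //.
by move: le_t1 le_t2; rewrite !sum_nat_const !card_ord; lia.
Qed.

Lemma leq_succ_expn_sqr k : k.+1 ^ k <= 2 ^ (k * k).
Proof. by case: k => // k; rewrite expnM leq_exp2r // ltn_expl. Qed.

Theorem theorem13 : fpt (bnsl_nonzero_by num_dependent).
Proof.
exists (compile 0 decide), (fun k => 89 * 3 * 2 ^ (k * k)), 1.
split=> [|I w [G listG /presentation_word def_w]].
  exact: computable_exp2_sqr.
exists (has (attains (raw_instance G) (truncated_target I))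
            (iota 0 (num_rankings (raw_instance G)))).
  exact: attains_yes.
apply: (@wp_outputs heap); apply: wp_conseq (decide_spec def_w) _ => t m _.
rewrite eqb0 negbK num_rankings_raw // => -[le_t ->]; split=> //.
apply: leq_trans le_t _; rewrite expn1 [leqRHS]mulnAC.
apply: leq_mul (leq_succ_expn_sqr _).
by rewrite def_w /=; have := size_raw_cells listG; lia.
Qed.
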